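(* Every (finite, simple) graph with at most $7$ vertices is a pairwise compatibility graph (PCG).
   Context: A graph $G=(V,E)$ is a pairwise compatibility graph (PCG) if there exist a tree $T$, an edge-weight function $w$ assigning positive real values to the edges of $T$, and two non-negative real numbers $d_{min}\le d_{max}$, such that each vertex $u\in V$ is associated bijectively to a leaf $l_u$ of $T$ (distinct vertices to distinct leaves, and every leaf of $T$ corresponds to a vertex of $G$) and, for all distinct $u,v\in V$, $(u,v)\in E$ if and only if $d_{min}\le d_{T,w}(l_u,l_v)\le d_{max}$, where $d_{T,w}(l_u,l_v)$ is the sum of the weights of the edges on the unique path from $l_u$ to $l_v$ in $T$. In this case one writes $G=PCG(T,w,d_{min},d_{max})$. *)

(* Defs.v *)
From mathcomp Require Import all_boot all_order all_algebra.
From mathcomp Require Import boolp classical_sets reals.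

Set Implicit Arguments.
Unset Strict Implicit.
Unset Printing Implicit Defensive.

Import GRing.Theory Num.Theory.

Local Open Scope ring_scope.

Definition simple_graph (V : finType) (e : rel V) : Prop :=
  symmetric e /\ irreflexive e.

(* [ucycle e c] also holds for c = [:: x; y] when x and y are adjacent, so
   genuine cycles are those of length at least 3.  The tree on an empty node
   type is not excluded; it has no leaves, hence can only represent the graph
   without vertices. *)
Definition tree (T : finType) (e : rel T) : Prop :=
  [/\ simple_graph e,
      forall x y : T, connect e x y
    & forall c : seq T, ucycle e c -> (size c <= 2)%N].

(* Degree 0 only occurs, in a tree, for the node of the one-node tree, which
   counts as a leaf: the one-vertex graph needs a tree with exactly one leaf. *)
Definition leaf (T : finType) (e : rel T) (x : T) : bool :=
  (#|[set y | e x y]| <= 1)%N.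

(* As in path.v, the path visits x :: p. *)
Definition simple_path (T : finType) (e : rel T) (x y : T) (p : seq T) : bool :=
  [&& path e x p, last x p == y & uniq (x :: p)].

(* In a tree exactly one p satisfies [simple_path e x y p], so the default
   value and the choice made by [xget] are irrelevant. *)
Definition tree_path (T : finType) (e : rel T) (x y : T) : seq T :=
  xget [::] [set p : seq T | simple_path e x y p]%classic.

Fixpoint path_weight (R : realType) (T : finType) (w : T -> T -> R)
    (x : T) (p : seq T) : R :=
  if p is y :: q then w x y + path_weight w y q else 0.

Definition tree_dist (R : realType) (T : finType) (e : rel T) (w : T -> T -> R)
    (x y : T) : R :=
  path_weight w x (tree_path e x y).

(* Symmetry makes w a function of the unordered edge {x, y}; its values on
   non-adjacent pairs are never used. *)
Definition edge_weight (R : realType) (T : finType) (e : rel T)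
    (w : T -> T -> R) : Prop :=
  (forall x y : T, w x y = w y x) /\ (forall x y : T, e x y -> 0 < w x y).

Definition leaf_labelling (V T : finType) (e : rel T) (l : V -> T) : Prop :=
  injective l /\ (forall t : T, leaf e t <-> exists v : V, l v = t).

Definition is_PCG (R : realType) (V : finType) (E : rel V) : Prop :=
  exists (T : finType) (e : rel T) (w : T -> T -> R) (l : V -> T)
         (dmin dmax : R),
    [/\ tree e, edge_weight e w, leaf_labelling e l, 0 <= dmin <= dmax
      & forall u v : V, u != v ->
          (E u v <-> dmin <= tree_dist e w (l u) (l v) <= dmax)].

(* Main.v *)
Require Import Defs.
From mathcomp Require Import all_boot all_order all_algebra.
From mathcomp Require Import reals.
From mathcomp Require Import boolp classical_sets zify.

(* Hang leaves u from the points p u of a line, by edges of length a u: their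
   mutual distances are a u + a v + |p u - p v|.  Distances of this form, from
   the 33 data (a, p) listed below and all windows [dmin, dmax], yield every
   graph on 7 vertices except the wheel, which is realized by hanging the six
   rim vertices and the hub from a star with three arms.  Forgetting leaves
   preserves the caterpillar form, and a graph with fewer than 7 vertices
   becomes one on 7 vertices, other than the wheel, by adding isolated vertices.

   That no graph is missed is a computation: the graphs with n + 1 vertices are
   obtained, up to isomorphism, by adding to those with n vertices a vertex of
   maximal degree in all possible ways. *)

Set Implicit Arguments.
Unset Strict Implicit.
Unset Printing Implicit Defensive.

Import Order.TTheory GRing.Theory Num.Theory.

(** * Trees given by a parent function *)

(** [tree_dist] follows a path obtained by choice and cannot be evaluated. The trees are therefore
    presented by a parent function on natural numbers together with a candidate distance [D], which
    only has to satisfy a recursion along parents. All lengths are natural numbers, so the data can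
    be checked by computation; the reals enter only when a tree is handed to [is_PCG]. Every leaf of
    the tree must carry a vertex, so a realization of a graph does not as it stands realize an
    induced subgraph: leaves have to be pruned, and with them the inner nodes that become leaves.
    For a caterpillar this amounts to dropping entries from the lists of lengths and positions,
    which is why the orders below seven reduce to order seven. The enumeration never tests
    isomorphism. Tables tell how to reorder each matrix: up to order six so that isomorphic
    extensions become equal and can be merged, at order seven so that the matrix occurs literally in
    the list of realized ones. A wrong entry could make the final check fail, but could not lose a
    graph. *)

Section ParentTree.

Variables (R : realType) (m : nat) (par w : nat -> nat) (D : nat -> nat -> nat).

Hypothesis par_lt : forall i, 0 < i -> par i < i.
Hypothesis w_gt0 : forall i, 0 < i <= m -> 0 < w i.
Hypothesis Dxx : forall i, D i i = 0.
Hypothesis DC : forall i j, D i j = D j i.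
(** Parents have smaller numbers, so the larger of two nodes is not an ancestor of the smaller and
    the path between them starts with the edge to its parent. With [Dxx] and [DC] this determines
    [D] on the tree. *)
Hypothesis D_par : forall i j, i < j <= m -> D i j = D i (par j) + w j.

(** The guard makes 0 the root, whatever the value of [par 0]. *)
Definition child (i j : nat) := (0 < j) && (par j == i).

Definition parent_rel : rel 'I_m.+1 := fun i j => child i j || child j i.

(** On an edge the larger node is the child, so [w j] is the length of the edge from [j] up to its
    parent. *)
Definition parent_weight (i j : 'I_m.+1) : R := ((w (maxn i j))%:R)%R.

Lemma child_lt i j : child i j -> i < j.
Proof. by case/andP=> j_gt0 /eqP <-; exact: par_lt. Qed.

Lemma parent_rel_sym : symmetric parent_rel.
Proof. by move=> i j; rewrite /parent_rel orbC. Qed.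

Lemma parent_rel_irr : irreflexive parent_rel.
Proof. by move=> i; apply/negbTE/negP; case/orP=> /child_lt; rewrite ltnn. Qed.

Lemma parent_rel_lt i j : parent_rel i j -> i < j -> par j = i.
Proof.
case/orP=> [/andP[_ /eqP]|/child_lt ji ij] //.
by move: (ltn_trans ij ji); rewrite ltnn.
Qed.

Lemma parent_rel_step i j : parent_rel i j -> (i < j) || (j < i).
Proof. by case/orP=> /child_lt ->; rewrite ?orbT. Qed.

Lemma parent_rel_connect i j : connect parent_rel i j.
Proof.
have conn0 : forall n (k : 'I_m.+1), k <= n -> connect parent_rel k ord0.
  elim=> [|n IHn] k le_kn.
    by rewrite (_ : k = ord0) //; apply/val_inj => /=; lia.
  have [k0|k_gt0] := posnP k; first by rewrite (_ : k = ord0) //; exact/val_inj.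
  have par_k := par_lt k_gt0.
  have lt_par : par k < m.+1 by have := ltn_ord k; lia.
  apply: (@connect_trans _ _ (Ordinal lt_par)); last by apply: IHn => /=; lia.
  by apply/connect1/orP; right; rewrite /child k_gt0 /=.
apply: (connect_trans (conn0 m i (ltn_ord i))).
by rewrite (sym_connect_sym parent_rel_sym); apply: conn0 (ltn_ord j).
Qed.

(* The largest node of a cycle would have two distinct parents. *)
Lemma parent_rel_acyclic c : ucycle parent_rel c -> size c <= 2.
Proof.
case/andP=> cyc_c uniq_c; rewrite leqNgt; apply/negP=> size_c.
have [x0 x0c] : exists x, x \in c.
  by case: c size_c {cyc_c uniq_c} => // x s _; exists x; rewrite mem_head.
case: (@arg_maxnP _ x0 (mem c) (@nat_of_ord _) x0c) => k kc k_max.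
have [i s def_s] := rot_to kc.
have mem_s x : x \in k :: s -> x <= k by rewrite -def_s mem_rot; exact: k_max.
move: cyc_c uniq_c size_c.
rewrite -(rot_cycle i) -(rot_uniq i) -(size_rot i) def_s.
case: s mem_s {def_s} => [|x s] // mem_s.
case/lastP: s mem_s => [|s y] // mem_s.
rewrite /= rcons_path last_rcons => /and3P[kx _ yk] /and3P[k_notin x_notin _] _.
have x_lt : x < k.
  have := mem_s x; rewrite !inE eqxx orbT => /(_ isT).
  by have := parent_rel_step kx; lia.
have y_lt : y < k.
  have := mem_s y; rewrite !inE mem_rcons inE eqxx !orbT => /(_ isT).
  by have := parent_rel_step yk; lia.
have eq_xy : x = y.
  apply/val_inj => /=; rewrite -(parent_rel_lt yk y_lt).
  by rewrite parent_rel_sym in kx; rewrite -(parent_rel_lt kx x_lt).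
by move: x_notin; rewrite eq_xy mem_rcons mem_head.
Qed.

Lemma parent_rel_tree : tree parent_rel.
Proof.
split; [by split; [exact: parent_rel_sym | exact: parent_rel_irr] | |].
- exact: parent_rel_connect.
- exact: parent_rel_acyclic.
Qed.

Lemma parent_weight_edge : edge_weight parent_rel parent_weight.
Proof.
split=> [x y|x y xy]; first by rewrite /parent_weight maxnC.
rewrite /parent_weight ltr0n; apply: w_gt0.
have := parent_rel_step xy; have := ltn_ord x; have := ltn_ord y; lia.
Qed.

(** The only smaller neighbour of a node is its parent. After a step down to a child, a step up
    would return to the node just left. *)
Lemma down_path (x y : 'I_m.+1) p :
  path parent_rel x (y :: p) -> uniq (x :: y :: p) -> x < y ->
  path (fun i j : 'I_m.+1 => i < j) x (y :: p).
Proof.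
elim: p x y => [|z p IHp] x y /=; first by move=> _ _ ->.
move=> /and3P[xy yz zp] /and4P[x_notin y_notin z_notin uniq_p] lt_xy.
rewrite lt_xy; apply: (IHp y z); rewrite /= ?yz ?y_notin ?z_notin //.
case/orP: (parent_rel_step yz) => // lt_zy.
suff eq_xz : x = z by move: x_notin; rewrite eq_xz !inE eqxx orbT.
apply/val_inj => /=; rewrite -(parent_rel_lt xy lt_xy).
by rewrite parent_rel_sym in yz; rewrite (parent_rel_lt yz lt_zy).
Qed.

Lemma first_step_up (x y : 'I_m.+1) p :
  path parent_rel x (y :: p) -> uniq (x :: y :: p) -> last y p < x -> y < x.
Proof.
move=> xp uniq_p lt_px; have /andP[xy _] := xp.
case/orP: (parent_rel_step xy) => // lt_xy.
have /allP lt_x := order_path_min (leT := fun i j : 'I_m.+1 => i < j)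
  (fun j i k => @ltn_trans j i k)
  (down_path xp uniq_p lt_xy).
by have /= := lt_x _ (mem_last y p); lia.
Qed.

(** If the first step goes up, it only lowers the starting point and induction applies; if it goes
    down, [down_path] makes the whole path increasing. *)
Lemma last_step_down (x y : 'I_m.+1) p :
  path parent_rel x (rcons p y) -> uniq (x :: rcons p y) -> x < y ->
  last x p < y.
Proof.
elim: p x => [|z p IHp] x //= /andP[xz zp] /andP[x_notin uniq_p] lt_xy.
case/orP: (parent_rel_step xz) => [lt_xz|lt_zx]; last first.
  by apply: IHp zp uniq_p _; lia.
have: path (fun i j : 'I_m.+1 => i < j) x (z :: rcons p y).
  by apply: down_path => //=; rewrite ?xz // x_notin.
by rewrite -rcons_cons rcons_path /= => /andP[].
Qed.

Lemma path_weight_rcons (T : finType) (wt : T -> T -> R) (x y : T) p :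
  path_weight wt x (rcons p y) = (path_weight wt x p + wt (last x p) y)%R.
Proof. by elim: p x => [|z p IHp] x /=; rewrite ?add0r ?addr0 // IHp addrA. Qed.

(** Remove the edge at the endpoint with the larger number: by [first_step_up] or [last_step_down]
    it joins that endpoint to its parent, and [D_par] accounts for it. Since the edge may be at
    either end, the induction is on a bound for the length. *)
Lemma simple_path_weight (x : 'I_m.+1) p :
  path parent_rel x p -> uniq (x :: p) ->
  path_weight parent_weight x p = ((D x (last x p))%:R)%R.
Proof.
move: {2}(size p) (leqnn (size p)) => n; elim: n x p => [|n IHn] x p.
  by case: p => //= _ _ _; rewrite Dxx.
case: p => [|y p] /=; first by rewrite Dxx.
move=> size_p /andP[xy yp] /andP[x_notin uniq_p].
have le_m (k : 'I_m.+1) : k <= m by rewrite -ltnS.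
case: (ltngtP x (last y p)) => [lt_x|gt_x|eq_x].
- move: x_notin uniq_p yp lt_x size_p xy.
  case/lastP: p => [|p z] x_notin uniq_p yp lt_x size_p xy.
    rewrite /= addr0 /parent_weight (maxn_idPr (ltnW lt_x)).
    by rewrite D_par ?lt_x ?le_m // (parent_rel_lt xy lt_x) Dxx.
  move: lt_x; rewrite last_rcons => lt_x.
  have xyz : path parent_rel x (rcons (y :: p) z) by rewrite /= xy.
  have uxyz : uniq (x :: rcons (y :: p) z) by rewrite /= x_notin.
  have lt_z := last_step_down xyz uxyz lt_x.
  have step_z : parent_rel (last x (y :: p)) z.
    by move: xyz; rewrite rcons_path => /andP[].
  rewrite -[LHS]/(path_weight parent_weight x (rcons (y :: p) z)).
  rewrite path_weight_rcons IHn; first last.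
  + by move: uxyz; rewrite -rcons_cons rcons_uniq => /andP[].
  + by move: xyz; rewrite rcons_path => /andP[].
  + by move: size_p; rewrite size_rcons.
  rewrite (D_par (j := z)) ?lt_x ?le_m // natrD.
  by rewrite (parent_rel_lt step_z lt_z) /parent_weight (maxn_idPr (ltnW lt_z)).
- have lt_yx : y < x.
    by apply: (@first_step_up x y p) => //=; rewrite ?xy ?x_notin.
  rewrite parent_rel_sym in xy.
  rewrite [D x _]DC (D_par (j := x)) ?gt_x ?le_m // (parent_rel_lt xy lt_yx).
  rewrite natrD addrC DC -IHn //.
  by rewrite /parent_weight (maxn_idPl (ltnW lt_yx)).
- by move: x_notin; rewrite (val_inj eq_x) mem_last.
Qed.

Lemma parent_tree_dist (x y : 'I_m.+1) :
  tree_dist parent_rel parent_weight x y = ((D x y)%:R)%R.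
Proof.
rewrite /tree_dist /tree_path.
have [p xp ->] := connectP (parent_rel_connect x y).
have [q xq uniq_q _] := shortenP xp.
have /(xgetPex [::]) /and3P[xr /eqP last_r uniq_r] :
    exists r, [set r | simple_path parent_rel x (last x q) r]%classic r.
  by exists q; apply/and3P.
by rewrite -{2}last_r; exact: simple_path_weight.
Qed.

End ParentTree.

(* Node 1 is a child of the root, so a further child keeps the root from being a
   leaf. *)
Lemma parent_tree_PCG (R : realType) (V : finType) (E : rel V) (m : nat)
    (par w : nat -> nat) (D : nat -> nat -> nat) (l : V -> nat) (lo hi : nat) :
  (forall i, 0 < i -> par i < i) ->
  (forall i, 0 < i <= m -> 0 < w i) ->
  (forall i, D i i = 0) -> (forall i j, D i j = D j i) ->
  (forall i j, i < j <= m -> D i j = D i (par j) + w j) ->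
  injective l -> (forall v, 0 < l v <= m) ->
  (forall v j, 0 < j <= m -> par j != l v) ->
  (exists2 j, 1 < j <= m & par j = 0) ->
  (forall i, 0 < i <= m ->
     (exists v, l v = i) \/ exists2 j, 0 < j <= m & par j = i) ->
  lo <= hi ->
  (forall u v, u != v -> E u v = (lo <= D (l u) (l v) <= hi)) ->
  is_PCG R E.
Proof.
move=> par_lt w_gt0 Dxx DC D_par l_inj l_bnd l_leaf [r r_bnd par_r] inner lohi.
move=> EE.
have l_lt v : l v < m.+1 by case/andP: (l_bnd v).
pose lo' v : 'I_m.+1 := Ordinal (l_lt v).
pose e := @parent_rel m par.
exists 'I_m.+1, e, (@parent_weight R m w), lo', (lo%:R)%R, (hi%:R)%R.
split.
- exact: parent_rel_tree.
- exact: parent_weight_edge.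
- split=> [u v [] /l_inj //|t]; split=> [leaf_t|[v <-]].
    have two_nbrs (i j : 'I_m.+1) : i != j -> e t i -> e t j -> False.
      move=> ij ti tj; move: leaf_t; rewrite /leaf leqNgt => /negP[].
      have <- : #|[set i; j]| = 2 by rewrite cards2 ij.
      apply/subset_leq_card; apply/fintype.subsetP=> k.
      by rewrite !inE => /orP[] /eqP ->.
    have ord_of k : 0 < k <= m -> k < m.+1 by case/andP.
    have [t0|t_gt0] := posnP t.
      have bnd1 : 0 < 1 <= m by lia.
      have bndr : 0 < r <= m by lia.
      case: (two_nbrs (Ordinal (ord_of _ bnd1)) (Ordinal (ord_of _ bndr))).
      + by rewrite -val_eqE /=; lia.
      + by apply/orP; left; rewrite /child /= t0; have := par_lt 1 isT; lia.
      + by apply/orP; left; rewrite /child /= t0 par_r; lia.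
    have t_bnd : 0 < t <= m by rewrite t_gt0 -ltnS ltn_ord.
    case: (inner t t_bnd) => [[v lv]|[j j_bnd par_j]].
      by exists v; exact: val_inj.
    have par_t : par t < m.+1 by have := par_lt t t_gt0; lia.
    case: (two_nbrs (Ordinal (ord_of _ j_bnd)) (Ordinal par_t)).
    + rewrite -val_eqE /=; have := par_lt t t_gt0; have := par_lt j.
      by rewrite par_j; case/andP: j_bnd => -> _ /(_ isT); lia.
    + by apply/orP; left; rewrite /child /= par_j eqxx andbT; case/andP: j_bnd.
    + by apply/orP; right; rewrite /child /= t_gt0 eqxx.
  (* A labelled node has no child, so its only possible neighbour is its parent. *)
  apply/card_le1_eqP=> i j; rewrite !inE /e /parent_rel /child /=.
  have no_child (k : 'I_m.+1) : (0 < k) && (par k == l v) = false.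
    apply/negbTE/negP=> /andP[k_gt0 par_k].
    by have := l_leaf v k; rewrite par_k k_gt0 -ltnS ltn_ord => /(_ isT).
  rewrite !no_child /= => /andP[_ /eqP par_i] /andP[_ /eqP par_j].
  by apply/ord_inj; rewrite -par_i -par_j.
- by rewrite ler0n ler_nat.
move=> u v uv; rewrite (parent_tree_dist R par_lt Dxx DC D_par) !ler_nat EE //=.
Qed.

(** The tree is [V] itself without edges. This case is apart because the spine node of a caterpillar
    with one leaf would be an unlabelled leaf. *)
Lemma small_PCG (R : realType) (V : finType) (E : rel V) :
  #|V| <= 1 -> is_PCG R E.
Proof.
move=> V1; have eqV (u v : V) : u = v by apply: (fintype_le1P V1).
exists V, (fun _ _ => false), (fun _ _ => 1%R), id, 0%R, 0%R; split.
- split=> [//|x y|c /andP[_ uniq_c]]; first by rewrite (eqV x y).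
  by rewrite -(card_uniqP uniq_c) (leq_trans (max_card _)) // (leq_trans V1).
- by split.
- split=> // t; split=> _; first by exists t.
  by rewrite /leaf (leq_trans (max_card _)).
- by rewrite lexx.
- by move=> u v; rewrite (eqV u v) eqxx.
Qed.

(** * Caterpillars as trees given by a parent function *)

Definition absdiff m n := (m - n) + (n - m).

(** Sorting the vertices by [p] gives the order along the spine, and injectivity of [p] makes the
    spine edges positive. With two vertices or more, each spine node has a spine neighbour besides
    its own leaf, hence is not a leaf. *)
Lemma caterpillar_PCG (R : realType) (V : finType) (E : rel V)
    (a p : V -> nat) (lo hi : nat) :
  1 < #|V| -> (forall v, 0 < a v) -> injective p -> lo <= hi ->
  (forall u v, u != v ->
     E u v = (lo <= a u + a v + absdiff (p u) (p v) <= hi)) ->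
  is_PCG R E.
Proof.
move=> V2 a_gt0 p_inj lohi EE.
have /card_gt0P[x0 _] : 0 < #|V| by exact: ltnW.
pose s := sort (fun u v => p u <= p v) (enum V).
have size_s : size s = #|V| by rewrite size_sort -cardE.
have s_uniq : uniq s by rewrite sort_uniq enum_uniq.
have s_mem v : v \in s by rewrite mem_sort mem_enum.
have rk_lt v : index v s < #|V| by rewrite -size_s index_mem.
pose P i := p (nth x0 s i); pose A i := a (nth x0 s i).
have P_mono i j : i < j < #|V| -> P i < P j.
  case/andP=> ij jV; rewrite ltn_neqAle; apply/andP; split.
    by apply/eqP=> /p_inj/eqP; rewrite nth_uniq ?size_s //; lia.
  have tr : transitive (fun u v => p u <= p v).
    by move=> ? ? ?; exact: leq_trans.
  have s_sorted : sorted (fun u v => p u <= p v) s.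
    by apply: sort_sorted => ? ?; exact: leq_total.
  by apply: (sorted_ltn_nth tr x0 s_sorted) => //; rewrite inE size_s //; lia.
(* Spine nodes are even, with node 2i + 1 the leaf hanging from node 2i. *)
pose h i := if odd i then A i./2 else 0.
pose D i j := if i == j then 0 else h i + h j + absdiff (P i./2) (P j./2).
pose w j := if odd j then A j./2 else P j./2 - P j./2.-1.
pose l v := (index v s).*2.+1.
have hl v : h (l v) = a v.
  by rewrite /h /l /= odd_double /= uphalf_double /A nth_index.
have lP v : P (l v)./2 = p v by rewrite /l /= uphalf_double /P nth_index.
have l_inj : injective l.
  by move=> u v []/double_inj/(congr1 (nth x0 s)); rewrite !nth_index.
(* Both 2i + 1 and 2i + 2 have parent 2i, and the last node is the leaf 2n - 1, where n is the
   number of vertices. *)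
apply: (@parent_tree_PCG R V E (#|V|.*2.-1) (fun j => j.-1./2.*2) w D l lo hi)
  => //.
- by move=> i; lia.
- move=> i i_bnd; rewrite /w; case: ifP => odd_i; first exact: a_gt0.
  by have := P_mono i./2.-1 i./2; lia.
- by move=> i; rewrite /D eqxx.
- by move=> i j; rewrite /D eq_sym /absdiff; case: eqP => // _; lia.
- move=> i j ij.
  rewrite /D /w (negbTE (_ : i != j)); last by lia.
  have [j_odd|j_even] := boolP (odd j).
    have par_j : j.-1./2.*2 = j.-1 by lia.
    have half_j : j.-1./2 = j./2 by lia.
    have h_par : h j.-1 = 0 by rewrite /h (_ : odd j.-1 = false) //; lia.
    have hj : h j = A j./2 by rewrite /h j_odd.
    rewrite par_j half_j h_par hj; case: eqP => [->|_]; last by lia.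
    by rewrite h_par half_j /absdiff; lia.
  have j_gt1 : 1 < j by lia.
  set k := j.-1./2.*2.
  have h_par : h k = 0 by rewrite /h odd_double.
  have half_k : k./2 = j./2.-1 by rewrite /k; lia.
  have hj : h j = 0 by rewrite /h (negbTE j_even).
  have Pj : P j./2.-1 < P j./2 by apply: P_mono; lia.
  rewrite h_par hj half_k; case: eqP => [->|/eqP neq_ik].
    by rewrite h_par half_k /absdiff; lia.
  (* A node before the even node j hangs from, or is, a spine node no later than the one preceding
     j, so the path to j crosses the whole last spine edge. *)
  have Pi : P i./2 <= P j./2.-1.
    have [->//|lt_i] := eqVneq i./2 j./2.-1.
    by apply/ltnW/P_mono; lia.
  by rewrite /absdiff; lia.
- by move=> v; have := rk_lt v; rewrite /l; lia.
- by move=> v j _; rewrite /l; lia.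
- by exists 2 => //; lia.
- move=> i i_bnd; case: (boolP (odd i)) => odd_i.
    left; exists (nth x0 s i./2); rewrite /l index_uniq ?size_s //; lia.
  by right; exists i.+1; lia.
- by move=> u v uv; rewrite /D (inj_eq l_inj) (negbTE uv) !hl !lP EE.
Qed.

(** * Graphs as adjacency matrices *)

Delimit Scope dec_uint_scope with dec_uint.

(* The tables write a sequence of digits as one decimal literal, whose leading
   zeros are significant. *)
Fixpoint digits_of (u : Decimal.uint) : seq nat :=
  match u with
  | Decimal.Nil => [::]
  | Decimal.D0 u => 0 :: digits_of u
  | Decimal.D1 u => 1 :: digits_of u
  | Decimal.D2 u => 2 :: digits_of u
  | Decimal.D3 u => 3 :: digits_of u
  | Decimal.D4 u => 4 :: digits_of u
  | Decimal.D5 u => 5 :: digits_of u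
  | Decimal.D6 u => 6 :: digits_of u
  | Decimal.D7 u => 7 :: digits_of u
  | Decimal.D8 u => 8 :: digits_of u
  | Decimal.D9 u => 9 :: digits_of u
  end.

Definition digits (u : Number.uint) : seq nat :=
  if u is Number.UIntDecimal d then digits_of d else [::].

Definition bmatrix := seq (seq bool).

Fixpoint bitvecs n : seq (seq bool) :=
  if n is n'.+1 then
    [seq false :: v | v <- bitvecs n'] ++ [seq true :: v | v <- bitvecs n']
  else [:: [::]].

Definition add_vertex (a : seq bool) (M : bmatrix) : bmatrix :=
  (false :: a) :: [seq br.1 :: br.2 | br <- zip a M].

Definition max_first (M : bmatrix) : bool :=
  let d := count id (head [::] M) in all (fun r => count id r <= d) M.

Definition extensions (M : bmatrix) : seq bmatrix :=
  [seq X <- [seq add_vertex a M | a <- bitvecs (size M)] | max_first X].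

Definition relabel (s : seq nat) (M : bmatrix) : bmatrix :=
  if [&& size s == size M, uniq s & all (fun i => i < size M) s] then
    [seq [seq nth false r j | j <- s] | r <- [seq nth [::] M i | i <- s]]
  else M.

Fixpoint relabel_all (ss : seq (seq nat)) (Ms : seq bmatrix) : seq bmatrix :=
  match ss, Ms with
  | s :: ss', M :: Ms' => relabel s M :: relabel_all ss' Ms'
  | _, _ => Ms
  end.

Definition next (us : seq Number.uint) (Ms : seq bmatrix) : seq bmatrix :=
  relabel_all (map digits us) (flatten (map extensions Ms)).

Definition adjacency (T : Type) (E : rel T) (s : seq T) : bmatrix :=
  [seq [seq E x y | y <- s] | x <- s].

(** Sequences take the place of vertex types so that a vertex can be deleted without changing the
    type. *)
Definition covers (n : nat) (Ms : seq bmatrix) : Prop :=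
  forall (T : eqType) (E : rel T) (s : seq T),
    symmetric E -> irreflexive E -> size s = n ->
    exists2 s', perm_eq s s' & adjacency E s' \in Ms.

(** * Completeness of the enumeration *)

Lemma mem_bitvecs a : a \in bitvecs (size a).
Proof.
elim: a => //= b a IHa; rewrite mem_cat.
by case: b; rewrite map_f // orbT.
Qed.

Lemma adjacency_cons (T : eqType) (E : rel T) x s :
  symmetric E -> irreflexive E ->
  adjacency E (x :: s) = add_vertex [seq E x y | y <- s] (adjacency E s).
Proof.
move=> symE irrE; rewrite /adjacency /add_vertex /= irrE zip_map -map_comp.
by congr (_ :: _); apply: eq_map => y /=; rewrite symE.
Qed.

Lemma relabel_adjacency (T : eqType) (E : rel T) (s : seq T) t :
  exists2 s', perm_eq s s' & adjacency E s' = relabel t (adjacency E s).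
Proof.
rewrite /relabel /adjacency size_map; case: ifP => [|_]; last by exists s.
case/and3P=> /eqP size_t uniq_t /allP lt_t.
have [/size0nil s_nil|] := posnP (size s).
  by exists s => //; move: size_t; rewrite s_nil; case: t {uniq_t lt_t}.
case Ds: {1}s => [//|x0 s1] _.
exists [seq nth x0 s i | i <- t].
  rewrite perm_sym -[X in perm_eq _ X](mkseq_nth x0) perm_map //.
  apply: uniq_perm; rewrite ?iota_uniq //.
  have sub_t : {subset t <= iota 0 (size s)}.
    by move=> i /lt_t; rewrite mem_iota.
  by have [] := uniq_min_size uniq_t sub_t _; rewrite ?size_iota ?size_t.
rewrite -!map_comp; apply/eq_in_map => i it /=.
rewrite (nth_map x0) ?lt_t // -map_comp; apply/eq_in_map => j jt /=.
by rewrite (nth_map x0) ?lt_t.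
Qed.

Lemma mem_relabel_all ss Ms M :
  M \in Ms -> exists t, relabel t M \in relabel_all ss Ms.
Proof.
(* The empty string stands for no relabelling, as for the matrices left over when the strings run
   out. *)
have relabel0 X : relabel [::] X = X by case: X.
elim: ss Ms => [|t ss IHss] [|X Ms] //=.
  by move=> M_in; exists [::]; rewrite relabel0.
rewrite inE => /orP[/eqP ->|/IHss[t' t'M]]; first by exists t; rewrite mem_head.
by exists t'; rewrite inE t'M orbT.
Qed.

Lemma ex_maximum (T : eqType) (f : T -> nat) (s : seq T) :
  s != [::] -> exists2 x, x \in s & all (fun y => f y <= f x) s.
Proof.
elim: s => // x s IHs _; have [->|/IHs[y ys max_y]] := eqVneq s [::].
  by exists x; rewrite ?mem_head //= leqnn.
have [le_xy|lt_yx] := leqP (f x) (f y).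
  by exists y; rewrite ?inE ?ys ?orbT //= le_xy.
exists x; rewrite ?mem_head //= leqnn; apply: sub_all max_y => z le_zy.
exact: leq_trans le_zy (ltnW lt_yx).
Qed.

(** Some vertex [x] attains the maximal degree. Delete it, reorder the rest as the hypothesis
    allows, and put [x] back in front: degrees do not depend on the order, so the filter [max_first]
    keeps the result. *)
Lemma covers_extensions n Ms :
  covers n Ms -> covers n.+1 (flatten (map extensions Ms)).
Proof.
move=> covMs T E s symE irrE size_s.
have [|x xs max_x] := @ex_maximum _ (fun y => count (E y) s) s.
  by case: s size_s.
have [|s' perm_s' adj_s'] := covMs T E (rem x s) symE irrE.
  by rewrite size_rem ?size_s.
have perm_s : perm_eq s (x :: s').
  by rewrite (permPl (perm_to_rem xs)) perm_cons.
exists (x :: s') => //; apply/flatten_mapP; exists (adjacency E s') => //.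
rewrite mem_filter; apply/andP; split.
  rewrite /max_first all_map; apply/allP=> y; rewrite -(perm_mem perm_s) => ys.
  change (is_true (count id [seq E y z | z <- x :: s'] <=
                   count id [seq E x z | z <- x :: s'])).
  by rewrite !count_map -!(permP perm_s); exact: (allP max_x).
apply/mapP; exists [seq E x y | y <- s']; last exact: adjacency_cons.
by rewrite size_map -(size_map (E x)) mem_bitvecs.
Qed.

Lemma covers_next n us Ms : covers n Ms -> covers n.+1 (next us Ms).
Proof.
move=> /covers_extensions covMs T E s symE irrE size_s.
have [s1 perm_s1] := covMs T E s symE irrE size_s.
case/(mem_relabel_all (map digits us))=> t tM.
have [s2 perm_s2 adj_s2] := relabel_adjacency E s1 t.
by exists s2; rewrite ?(perm_trans perm_s1) // adj_s2.
Qed.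

(** [undup] is what limits the growth: it merges the matrices that the relabellings made equal. *)
Definition representatives (uss : seq (seq Number.uint)) : seq bmatrix :=
  foldl (fun Ms us => undup (next us Ms)) [:: [::]] uss.

Lemma covers_representatives uss : covers (size uss) (representatives uss).
Proof.
elim/last_ind: uss => [|uss us IH].
  by move=> T E s _ _ /size0nil ->; exists [::].
rewrite size_rcons /representatives foldl_rcons => T E s symE irrE size_s.
have [s' perm_s' adj_s'] := covers_next us IH symE irrE size_s.
by exists s'; rewrite ?mem_undup.
Qed.

(* Membership in the list of thousands of realizable matrices is tested in a
   prefix tree. *)
Inductive trie := Leaf | Node of bool & trie & trie.

Definition tchild (b : bool) (t : trie) : trie :=
  if t is Node _ l r then (if b then r else l) else Leaf.

Definition thas (t : trie) : bool := if t is Node b _ _ then b else false.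

Fixpoint tmem (k : seq bool) (t : trie) : bool :=
  if k is b :: k' then tmem k' (tchild b t) else thas t.

Fixpoint tadd (k : seq bool) (t : trie) : trie :=
  if k is b :: k' then
    if b then Node (thas t) (tchild false t) (tadd k' (tchild true t))
    else Node (thas t) (tadd k' (tchild false t)) (tchild true t)
  else Node true (tchild false t) (tchild true t).

Lemma tmem_tadd k k' t : tmem k (tadd k' t) = (k == k') || tmem k t.
Proof.
elim: k' k t => [|b' k' IHk] [|b k] [|c l r] //=; try by case: b'.
- by case: b.
- by case: b'; case: b; rewrite /= ?IHk ?eqseq_cons.
- by case: b'; case: b; rewrite /= ?IHk ?eqseq_cons.
Qed.

Definition trie_of (ks : seq (seq bool)) : trie := foldr tadd Leaf ks.

Lemma tmem_trie_of k ks : tmem k (trie_of ks) = (k \in ks).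
Proof. by elim: ks => [|k' ks IH]; [elim: k | rewrite /= tmem_tadd IH]. Qed.

(* The binding makes evaluation build the tree once. *)
Definition trie_includes (ks : seq (seq bool)) (Ms : seq bmatrix) : bool :=
  let t := trie_of ks in all (fun M => tmem (flatten M) t) Ms.

Lemma trie_subset (Ms : seq bmatrix) ks :
  trie_includes ks Ms -> {subset map flatten Ms <= ks}.
Proof.
by move/allP=> in_ks k /mapP[M /in_ks M_in ->]; rewrite -tmem_trie_of.
Qed.

(** * The wheel *)

Definition wheel : bmatrix :=
  [seq [seq (i != j) && [|| i == 6, j == 6, j == i.+1 %% 6 | i == j.+1 %% 6]
       | j <- iota 0 7] | i <- iota 0 7].

(* Node 0 is the centre, 1, 2, 3 its neighbours, 4 the leaf of the hub; the arms
   end in the leaves of opposite rim vertices, one near and one far. *)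
Definition wheel_parent : nat -> nat :=
  nth 0 [:: 0; 0; 0; 0; 0; 1; 2; 3; 1; 2; 3].

Definition wheel_weight : nat -> nat :=
  nth 0 [:: 0; 1; 1; 1; 3; 1; 3; 1; 3; 1; 3].

Definition wheel_leaf (k : nat) : nat := if k == 6 then 4 else k + 5.

(** Each step replaces the larger node by its parent. Paths in this tree have at most four edges, so
    the fuel 11 does not run out. *)
Fixpoint wheel_up (fuel i j : nat) : nat :=
  if fuel is f.+1 then
    if i == j then 0
    else
      let k := wheel_parent j in
      wheel_up f (minn i k) (maxn i k) + wheel_weight j
  else 0.

Definition wheel_dist (i j : nat) : nat := wheel_up 11 (minn i j) (maxn i j).

Lemma wheel_dist_parent i j : i < j <= 10 ->
  wheel_dist i j = wheel_dist i (wheel_parent j) + wheel_weight j.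
Proof.
have /allP chk : all (fun j => all (fun i => wheel_dist i j ==
    wheel_dist i (wheel_parent j) + wheel_weight j) (iota 0 j)) (iota 0 11).
  by vm_compute.
case/andP=> ij j10; have := chk j; rewrite mem_iota => /(_ j10)/allP/(_ i).
by rewrite mem_iota => /(_ ij)/eqP.
Qed.

(** Near and far leaves alternate around the rim. The hub is at distance 5 or 7 from the rim leaves
    and consecutive rim leaves are at distance 6; rim leaves two steps apart are at distance 4 or 8,
    opposite ones, on the same arm, at distance 4. *)
Lemma wheel_adjacent i j : i < 7 -> j < 7 -> i != j ->
  nth false (nth [::] wheel i) j =
  (5 <= wheel_dist (wheel_leaf i) (wheel_leaf j) <= 7).
Proof.
have /allP chk : all (fun i => all (fun j => (i != j) ==>
    (nth false (nth [::] wheel i) j ==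
     (5 <= wheel_dist (wheel_leaf i) (wheel_leaf j) <= 7))) (iota 0 7)) (iota 0 7).
  by vm_compute.
move=> i7 j7 ij; have := chk i; rewrite mem_iota => /(_ i7)/allP/(_ j).
by rewrite mem_iota => /(_ j7)/implyP/(_ ij)/eqP.
Qed.

(** Surjectivity of [q] ensures that every leaf of the star is labelled. *)
Lemma wheel_PCG (R : realType) (V : finType) (E : rel V) (q : V -> nat) :
  injective q -> (forall v, q v < 7) ->
  (forall k, k < 7 -> exists v, q v = k) ->
  (forall u v, u != v -> E u v = nth false (nth [::] wheel (q u)) (q v)) ->
  is_PCG R E.
Proof.
move=> q_inj q_lt q_surj EE.
apply: (@parent_tree_PCG R V E 10 wheel_parent wheel_weight wheel_dist
  (wheel_leaf \o q) 5 7) => //.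
- by do 12?[case=> //].
- by do 12?[case=> //].
- by move=> i; rewrite /wheel_dist minnn maxnn /wheel_up eqxx.
- by move=> i j; rewrite /wheel_dist minnC maxnC.
- exact: wheel_dist_parent.
- move=> u v; rewrite /wheel_leaf /= => eq_l; apply: q_inj.
  by move: eq_l; have := q_lt u; have := q_lt v; do 2!case: eqP => //; lia.
- by move=> v; rewrite /wheel_leaf /=; have := q_lt v; case: eqP => //; lia.
- move=> v j j_bnd; have lv : 4 <= wheel_leaf (q v).
    by rewrite /wheel_leaf; case: eqP; lia.
  have : wheel_parent j < 4 by move: j j_bnd; do 11?[case=> //].
  by rewrite /=; lia.
- by exists 2.
- move=> i i_bnd; have [i_lt4|i_ge4] := ltnP i 4.
    right; exists (i + 4); first by lia.
    by move: i i_lt4 i_bnd; do 4?[case=> //].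
  (* Node 4 is the hub leaf, and node i >= 5 is the leaf of the rim vertex i - 5. *)
  left; have [v qv] : exists v, q v = if i == 4 then 6 else i - 5.
    by apply: q_surj; case: eqP; lia.
  exists v; rewrite /wheel_leaf /= qv.
  by case: (i =P 4) => [->//|]; case: eqP; lia.
- by move=> u v uv; rewrite EE // wheel_adjacent // (inj_eq q_inj).
Qed.

(** * Caterpillars *)

Definition cat_dist (a p : seq nat) (i j : nat) : nat :=
  if i == j then 0 else nth 0 a i + nth 0 a j + absdiff (nth 0 p i) (nth 0 p j).

Definition cat_matrix (a p : seq nat) : seq (seq nat) :=
  [seq [seq cat_dist a p i j | j <- iota 0 7] | i <- iota 0 7].

Definition window (D : seq (seq nat)) (lo hi : nat) : bmatrix :=
  [seq [seq lo <= d <= hi | d <- r] | r <- D].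

(** A window containing some distance can be shrunk until its bounds are distances. The value 1 is
    below all distances between distinct leaves, which are at least 3, so the window [1, 1] gives
    the edgeless graph. Requiring a positive lower bound keeps the diagonal false, as in an
    adjacency matrix. *)
Definition windows (D : seq (seq nat)) : seq (nat * nat) :=
  let vs := 1 :: undup (flatten D) in
  [seq w <- [seq (lo, hi) | lo <- vs, hi <- vs] | 0 < w.1 <= w.2].

Definition positions (g : seq nat) : seq nat := 0 :: scanl addn 0 g.

Definition graphs_of (ap : seq nat * seq nat) : seq bmatrix :=
  let D := cat_matrix ap.1 ap.2 in
  [seq window D w.1 w.2 | w <- windows D].

(* The digits of a pair are the leaf edge lengths and the spine edge lengths of a
   caterpillar with 7 leaves, found by random search. *)
Definition caterpillars : seq (Number.uint * Number.uint) := [::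
  (8528827, 992271); (7914216, 696728); (8551875, 946638); (3922696, 514179);
  (9817199, 663938); (4256919, 412958); (2884811, 239657); (9939129, 523289);
  (1831961, 819187); (6129879, 756639); (1984523, 996251); (9317428, 861186);
  (9466281, 932118); (2735961, 623951); (5277388, 727268); (2129493, 746931);
  (3291194, 444526); (7329196, 889226); (7782153, 751421); (9219974, 989881);
  (9871813, 846344); (7824598, 936637); (7183342, 152446); (4874637, 912927);
  (3688173, 571339); (7918391, 717222); (5871925, 675944); (7193345, 347632);
  (7864255, 951386); (1253287, 241249); (1994815, 332347); (1217271, 721772);
  (3172223, 351866)]%dec_uint.

Definition caterpillar_data : seq (seq nat * seq nat) :=
  [seq (digits t.1, positions (digits t.2)) | t <- caterpillars].

Definition caterpillar_graphs : seq bmatrix :=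
  flatten (map graphs_of caterpillar_data).

Lemma caterpillar_data_valid ap : ap \in caterpillar_data ->
  [/\ size ap.1 = 7, all (leq 1) ap.1, size ap.2 = 7 & uniq ap.2].
Proof.
have /allP chk : all (fun ap => [&& size ap.1 == 7, all (leq 1) ap.1,
    size ap.2 == 7 & uniq ap.2]) caterpillar_data by vm_compute.
by move/chk=> /and4P[/eqP ? ? /eqP ? ?]; split.
Qed.

Lemma nth_window (a p : seq nat) lo hi i j : i < 7 -> j < 7 ->
  nth false (nth [::] (window (cat_matrix a p) lo hi) i) j =
  (lo <= cat_dist a p i j <= hi).
Proof.
move=> i7 j7.
have row_i :
    nth [::] (cat_matrix a p) i = [seq cat_dist a p i k | k <- iota 0 7].
  by rewrite (nth_map 0) ?size_iota // nth_iota.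
rewrite (nth_map [::]) ?size_map ?size_iota // row_i.
rewrite (nth_map 0) ?size_map ?size_iota //.
by rewrite (nth_map 0) ?size_iota // nth_iota.
Qed.

(** [q] need not be onto: leaves outside its image are dropped, and [caterpillar_PCG] builds a spine
    from the remaining positions. *)
Lemma caterpillar_graph_PCG (R : realType) (V : finType) (E : rel V)
    (q : V -> nat) (M : bmatrix) :
  1 < #|V| -> injective q -> (forall v, q v < 7) -> M \in caterpillar_graphs ->
  (forall u v, u != v -> E u v = nth false (nth [::] M (q u)) (q v)) ->
  is_PCG R E.
Proof.
move=> V2 q_inj q_lt /flatten_mapP[[a p] /caterpillar_data_valid[/=]].
move=> size_a a_gt0 size_p p_uniq /mapP[[lo hi]].
rewrite mem_filter => /andP[/andP[_ lohi] _] -> EE.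
apply: (@caterpillar_PCG R V E (nth 0 a \o q) (nth 0 p \o q) lo hi) => //=.
- by move=> v; apply: (allP a_gt0); rewrite mem_nth ?size_a.
- by move=> u v /eqP; rewrite nth_uniq ?size_p // => /eqP/q_inj.
- move=> u v uv; rewrite EE // nth_window // /cat_dist.
  by rewrite (inj_eq q_inj) (negbTE uv).
Qed.

(** * All graphs with seven vertices *)

(* The strings for [relabel] to use on the successive graphs produced by
   [extensions].  Nothing is assumed of them: [relabel] ignores a string that
   is not a permutation. *)
Definition relabellings : seq (seq Number.uint) := [::
  [::
   0];
  [::
   01; 01];
  [::
   012; 012; 021; 012; 012];
  [::
   0123; 0123; 0132; 0123; 0231; 0213; 0312; 0123; 0123; 0123; 0123; 0321;
   0123; 0123; 0123; 0123];
  [::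
   01234; 01234; 01243; 01234; 01342; 01324; 01423; 01234; 02341; 02314;
   02413; 02134; 03412; 03124; 04123; 01234; 01234; 01234; 01324; 01324;
   01234; 01234; 01234; 04231; 01234; 04321; 01324; 04231; 01234; 01234;
   01234; 01243; 01234; 01234; 01234; 01243; 01234; 01234; 01234; 34120;
   01234; 23410; 01234; 14320; 02143; 02143; 12340; 03214; 04123; 01234;
   01234; 02134; 01234; 04132; 01234; 01234; 01234; 43021; 12034; 04321;
   01234; 01234; 01234; 34012; 34021; 12034; 12043; 01234; 01234; 01234];
  [::
   012345; 012345; 012354; 012345; 012453; 012435; 012534; 012345; 013452;
   013425; 013524; 013245; 014523; 014235; 015234; 012345; 023451; 023415;
   023514; 023145; 024513; 024135; 025134; 021345; 034512; 034125; 035124;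
   031245; 045123; 041235; 051234; 012345; 012345; 012345; 012435; 012435;
   012345; 012345; 013425; 013425; 013245; 013245; 014235; 014235; 012345;
   012345; 012345; 052341; 012345; 052431; 012435; 052341; 012345; 053421;
   013425; 053241; 013245; 054231; 014235; 052341; 012345; 012345; 012345;
   012354; 012345; 013245; 013254; 013245; 012345; 012345; 012354; 012345;
   012345; 012345; 012354; 012345; 013245; 013254; 013245; 012345; 012345;
   012354; 012345; 012345; 012345; 012435; 012534; 012345; 012345; 012345;
   012435; 012534; 012345; 012345; 012345; 453120; 012345; 012345; 021354;
   012345; 012345; 243510; 012345; 015342; 012345; 015342; 012345; 153420;
   021354; 021354; 024351; 024351; 021354; 021354; 123450; 042315; 051324;
   012345; 045312; 042315; 051324; 012345; 012345; 012435; 012345; 012345;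
   012345; 015342; 012345; 015432; 012435; 015342; 012345; 012345; 012435;
   012345; 012345; 012345; 015342; 012345; 015432; 012435; 015342; 012345;
   102345; 501342; 012345; 012435; 201345; 012345; 021345; 021435; 102345;
   021345; 012345; 051342; 012345; 051432; 012435; 051342; 012345; 102345;
   012345; 012345; 012345; 213450; 504321; 012345; 012345; 540321; 012345;
   102345; 012345; 120345; 054321; 012345; 054321; 054321; 054321; 012345;
   012345; 012345; 012345; 015342; 012345; 012345; 012345; 012345; 015342;
   012345; 012345; 102345; 102435; 012345; 012345; 012345; 102345; 102435;
   012345; 012345; 012345; 012345; 453120; 450312; 012345; 012354; 012345;
   450321; 021345; 021354; 021345; 120345; 120354; 012345; 123450; 045312;
   054312; 012345; 012345; 012345; 012345; 012354; 012345; 012345; 012345;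
   012345; 012354; 012345; 102345; 201345; 102345; 012345; 012345; 012354;
   012345; 102345; 201435; 102345; 102345; 201435; 012345; 012345; 012345;
   012345; 012345; 012345; 021345; 120345; 120435; 120534; 012345; 012345;
   012345; 012345; 012345; 014325; 012543; 012345; 032145; 012345; 052143;
   012345; 034125; 032541; 032145; 054123; 014325; 052143; 012345; 012345;
   012345; 543012; 210435; 012345; 012345; 120345; 534021; 021435; 021435;
   120345; 124350; 012345; 213450; 021435; 012345; 012345; 345201; 012345;
   012345; 012543; 012345; 012345; 012345; 012345; 012543; 012345; 012345;
   012345; 012345; 021345; 031245; 012345; 051243; 012345; 012345; 012345;
   345120; 451032; 234015; 234510; 012345; 154320; 154023; 345021; 021543;
   215430; 123054; 032154; 123450; 043215; 051234; 012345; 012345; 012345;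
   012345; 120345; 012543; 012345; 012345; 012345; 543021; 154230; 123045;
   054321; 012345; 012345; 012345; 012345; 012345; 021345; 120345; 120345;
   120543; 012345; 012345; 012345; 012345; 012345]]%dec_uint.

(** Here the target is not a canonical form but a matrix found among the windows of the
    caterpillars, or [wheel] itself. *)
Definition relabellings7 : seq Number.uint := [::
  0123456; 0123456; 0123456; 0123456; 0123456; 0123456; 0123456; 0123456;
  0123456; 0123465; 0123456; 0123456; 0123456; 0123456; 0123456; 0123456;
  0123456; 0123456; 0123456; 0123456; 0123456; 0123456; 0123465; 0123456;
  0123456; 0123465; 0123456; 0123456; 0123456; 0123465; 0123456; 0123456;
  0123456; 0123645; 0123546; 0152634; 0123456; 0142635; 0142536; 0145623;
  0123456; 0132645; 0132546; 0135624; 0132456; 0134625; 0134526; 0134562;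
  0123456; 0123645; 0123546; 0125634; 0123456; 0124635; 0124536; 0124563;
  0123456; 0123645; 0123546; 0123564; 0123456; 0123465; 0123456; 0123456;
  0123456; 0123456; 0123456; 0123456; 0123456; 0123456; 0123456; 0123465;
  0123456; 0123456; 0123456; 0123546; 0123456; 0123456; 0123456; 0126345;
  0123564; 0132456; 0123465; 0132546; 0123465; 0123465; 0123456; 0142536;
  0123546; 0124365; 0123456; 0125364; 0123456; 0123456; 0126345; 0123546;
  1605234; 0123456; 1604235; 0142536; 1024635; 0123456; 1603245; 0132546;
  1023645; 0132456; 1023654; 0134526; 1345620; 0123465; 1602345; 0123546;
  1032645; 0123456; 1032654; 0124536; 1245630; 0124356; 1042653; 0123546;
  1235640; 0123456; 1234650; 0123456; 0123456; 0123456; 0123465; 0123456;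
  0123456; 0123654; 0123564; 0123564; 0123456; 0123456; 0123456; 0123456;
  0126534; 0125634; 0125634; 0123456; 0123456; 0123465; 0123456; 0123456;
  0124356; 0124365; 0124356; 0123456; 0123456; 0123456; 0123456; 2340156;
  0125436; 0126435; 1024536; 0125346; 0126345; 1023546; 0123456; 0526341;
  0625341; 2516034; 0135246; 0136245; 1032546; 0132456; 0536241; 0635241;
  2413056; 0142356; 0546231; 0645231; 2314056; 0123456; 0123456; 0123465;
  0123456; 0123456; 0123546; 0123456; 0123456; 0123456; 0125643; 0124653;
  0124563; 0124563; 0123645; 0123546; 0123564; 0123456; 0123465; 0123456;
  0123456; 2405163; 0125346; 0124356; 0124365; 0124356; 0135246; 0134256;
  0134265; 0134256; 0456213; 0465213; 1235640; 0564213; 1234650; 1234560;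
  2345601; 0123456; 0124563; 0123564; 0123465; 0123456; 0123456; 0123456;
  0345621; 0435621; 0534621; 0634521; 2345601; 0123456; 2345601; 0123456;
  0123456; 0125463; 0123456; 0564312; 0123456; 0125364; 0124356; 0563412;
  0123456; 0364125; 0354216; 0356412; 0125364; 0125364; 1025634; 0123456;
  0125463; 0254361; 1526034; 0123456; 0125364; 0253461; 1526043; 0324165;
  1052346; 0325461; 1235604; 0163452; 0125634; 1036524; 0145236; 0164352;
  0145236; 1503642; 0135246; 0163452; 0135246; 1504632; 0314256; 0316452;
  1250634; 1650234; 0123456; 1032564; 1025634; 1530426; 0124356; 1025364;
  1503246; 3150246; 0123456; 1025463; 1504236; 3150246; 0312456; 1234056;
  1250634; 1502346; 0245361; 0254361; 0123456; 0245361; 0163245; 0123546;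
  0245361; 0123456; 0254361; 0123456; 0364521; 0236145; 0253461; 1450326;
  0243561; 1540326; 0243561; 1450326; 0123456; 0236145; 0325164; 2045613;
  0324165; 2054613; 0245361; 1245603; 0135642; 0134652; 0134256; 0134652;
  0163452; 2630514; 2461035; 2630415; 2561034; 2064531; 2604531; 2401563;
  0135246; 3260145; 0134256; 3260154; 0134256; 1450326; 0123456; 1024563;
  2016345; 2016345; 2016354; 2016354; 2016345; 2016345; 0643521; 0634521;
  0635421; 0123456; 0634521; 2560314; 2460315; 0243561; 2603451; 2360415;
  0234561; 2604351; 0235461; 2605341; 0234561; 3245016; 6024513; 6023514;
  6023415; 2630145; 6345021; 2016534; 2016435; 2064513; 2016435; 2016345;
  2063514; 2016345; 2063415; 2016354; 2345061; 2016345; 0451263; 1245603;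
  0351264; 1235604; 0341265; 1234605; 1326405; 1234605; 2601534; 2601435;
  1420563; 3142605; 2601345; 1320564; 4132605; 1320465; 5132604; 1362405;
  1326405; 1602534; 1602435; 2410563; 3162045; 1602345; 2310564; 4162035;
  2310465; 5162034; 2361405; 1602345; 3450126; 1206534; 3412605; 1206435;
  3401265; 3126045; 3126045; 1206345; 3120645; 4126035; 4126035; 5126034;
  5126034; 1206345; 1206345; 0123456; 0123456; 0124356; 0124356; 0123456;
  0346125; 0123456; 0123456; 0256341; 0256341; 0123456; 0165423; 0123456;
  0123456; 0123546; 0165324; 0124356; 0124356; 0123546; 1056342; 0123546;
  0123546; 0136524; 2460153; 0213456; 0213456; 2360154; 0214356; 0214356;
  0314652; 2160534; 1356024; 1354602; 0612534; 0521346; 3210645; 0123456;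
  0563421; 0653421; 3150642; 0124356; 0564321; 0654321; 3214065; 0123456;
  1324650; 0123456; 0123456; 1460523; 1360524; 0632415; 2561304; 2135604;
  0125634; 2601453; 1420563; 2610543; 2601354; 1320564; 2610534; 0236415;
  3124650; 3620145; 3410265; 3561042; 3501624; 0163425; 2106534; 0163425;
  2601534; 3402615; 3521046; 2610543; 4302615; 3501264; 2610534; 0123465;
  3124650; 0123465; 0123465; 0123456; 0365124; 0364125; 0123456; 0123456;
  0461523; 0561423; 0645321; 3145602; 1642503; 0123456; 1046532; 0123546;
  1056432; 0123456; 0123456; 2645301; 3254601; 3245601; 6124503; 2456103;
  3560142; 3460152; 0645321; 3601245; 1064523; 0123456; 3254601; 0123546;
  3245601; 0123456; 0123456; 0136452; 3246015; 3052614; 3042615; 0132456;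
  0132456; 4253610; 3450126; 3052614; 3042615; 4653210; 2456103; 0123456;
  1036452; 1046352; 1056342; 0634521; 0634521; 6345021; 4253601; 3254601;
  3245601; 0634521; 0634521; 0123456; 2346015; 0123456; 0124356; 1234506;
  0346125; 0345126; 0563412; 0235614; 0123465; 0123456; 0123456; 0124365;
  0124356; 0124356; 0342561; 1346502; 1345602; 0563421; 0135624; 0213465;
  0213456; 0213456; 0214365; 0214356; 0214356; 0341562; 1056342; 1065342;
  0563412; 0612345; 0512346; 1205634; 0123456; 0563412; 0653412; 4120536;
  0124356; 0564312; 0654312; 3120546; 0123456; 0123465; 0123456; 0123456;
  0123456; 0124563; 0123465; 0123456; 0123456; 0245613; 4653012; 4563012;
  1254603; 0123654; 0123564; 1045632; 0123456; 0123465; 0123456; 0123456;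
  2560143; 0213564; 0213465; 0213456; 0213456; 0521643; 3265014; 3256014;
  4563012; 0546312; 0645312; 1045632; 0123546; 0123645; 0123546; 0123546;
  0234516; 0156432; 0165432; 0453612; 0156342; 0165342; 0354612; 0156324;
  0635421; 0536421; 3456021; 0235461; 1246350; 1245360; 0235461; 1236450;
  1235460; 0245361; 1056324; 1653420; 1563420; 3421056; 1340562; 1203465;
  1203456; 1203456; 1204365; 1204356; 1204356; 0134256; 0153642; 0163542;
  5364021; 1036425; 1035426; 1023456; 2054613; 1340625; 1340526; 1023456;
  2053614; 1430625; 1430526; 1024356; 2015634; 2015634; 2016534; 1023456;
  0156432; 0156342; 0156342; 0536421; 0156342; 0236451; 0246513; 0246513;
  0236451; 0236514; 0236514; 0246351; 0653421; 1056342; 5102346; 3421056;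
  0156432; 0156342; 2634501; 5023416; 0156342; 2036451; 3150642; 2064513;
  3106542; 3264051; 2063514; 4106532; 0341625; 1056324; 5012364; 2015634;
  0536421; 1035642; 1045632; 1056342; 1065342; 0536421; 0156342; 1035642;
  1045632; 1056342; 1065342; 0536421; 1245603; 1235604; 1236450; 1235460;
  1235604; 2510643; 2510634; 1236450; 1235460; 1562304; 1520643; 1520634;
  2136450; 2135460; 2561304; 3501426; 3406125; 3405126; 1520643; 3056412;
  3065412; 1520634; 0123456; 0123456; 0123465; 0123456; 4653102; 0156342;
  0246351; 1245603; 0156342; 3164205; 3042651; 2436501; 1245603; 0156342;
  3265104; 1536402; 3051642; 2154603; 0246351; 3416025; 3526014; 3401256;
  3410265; 3401625; 0352614; 3402165; 0341625; 3406125; 4210653; 6102435;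
  0135642; 5601324; 3052614; 1236450; 1235460; 0135642; 0135642; 3450162;
  3052614; 0123456; 0123465; 0123456; 0234516; 0243516; 0156324; 0165324;
  1563420; 2560413; 2560314; 0156324; 0165324; 1563420; 0234516; 0243516;
  1340625; 1340526; 1563420; 1023456; 1340625; 1340526; 1023456; 1430625;
  1430526; 1024356; 2015634; 1340625; 1340526; 1023456; 0156342; 0236451;
  0246351; 0123465; 5210634; 0156342; 0156342; 0236451; 0246351; 0156324;
  5120634; 0156342; 0123456; 0123456; 0123456; 0356124; 0346125; 0345126;
  1023456; 0123456; 0123564; 0123465; 0123456; 0123456; 0213456; 0213564;
  0213465; 0213456; 0213456; 5601243; 4601253; 4501263; 4501263; 0123465;
  0123456; 0123564; 0123546; 0123465; 0123456; 0123456; 0123564; 0156324;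
  3462105; 3452106; 0356412; 1564302; 2104563; 4102365; 4102356; 3456012;
  1203564; 2563401; 3201465; 3201456; 4356021; 3150624; 0462513; 0452613;
  0452613; 0361524; 0351624; 0351624; 3021456; 3021456; 3021465; 3021456;
  0456321; 1456302; 3210456; 3210546; 3210645; 0456321; 0145632; 1456302;
  1045632; 1054632; 1064532; 0456321; 0456312; 0456321; 0456312; 4501263;
  1204563; 1205463; 1206453; 0456312; 3201456; 0235641; 0145632; 0214563;
  0123564; 3021456; 3021465; 0145632; 0123456; 0123456; 3456012; 3456012;
  3456012; 1203456; 1204356; 1205346; 1206345; 3456120; 0123456; 0156243;
  0126435; 0135426; 1452036; 1420365; 0135642; 1423065; 0123465; 1234506;
  1354620; 1436025; 0126543; 1430256; 1432056; 0132456; 1254036; 1203456;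
  1425036; 0123546; 1452036; 1462053; 2510436; 1234560; 1436052; 1425063;
  1425036; 0164235; 0154326; 1230456; 2530146; 1425036; 1436025; 1452036;
  0134265; 2541036; 1260453; 1360245; 1425063; 1420536; 1436025; 1436025;
  0124356; 1350462; 2536041; 1250346; 1436052; 1425036; 1430625; 1425036;
  1450623; 1360542; 1250643; 1250346; 1425063; 1436052; 1425063; 1250346;
  0452136; 1346520; 0346512; 2541036; 1435602; 2501364; 0124536; 0256134;
  0425136; 1346250; 1234650; 1342605; 0346215; 0253164; 1360425; 1432605;
  3462105; 1630425; 1236504; 0146532; 2543016; 1360452; 1465302; 0136245;
  0143562; 0143562; 2546013; 2540136; 1360452; 1360452; 0146235; 0251364;
  1630245; 1360425; 1462305; 3610425; 1630245; 0143265; 0143265; 1360245;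
  1360425; 1360425; 1360425; 1360245; 1360425; 0234516; 1643025; 0243561;
  0465312; 2503461; 2506431; 1624350; 2435106; 0324561; 0256314; 0234561;
  1643052; 1324605; 2503461; 0235461; 0462315; 2465031; 1463025; 1643502;
  2105643; 1624350; 1643025; 1320465; 2534601; 0315462; 2530146; 2543106;
  1460532; 2540631; 2501346; 2501346; 2345601; 2501346; 1350462; 0251463;
  2530146; 0312465; 5230146; 2530614; 1460325; 1460235; 5240631; 2504316;
  6310425; 2605134; 2315064; 3206451; 1360245; 1346520; 2036514; 2530164;
  1643520; 5102346; 0256314; 1346250; 2530164; 2503461; 2504361; 0253614;
  2540136; 1643250; 2105346; 2506431; 1346025; 2503164; 2540136; 2530164;
  2506134; 2503164; 2304561; 5203164; 2504136; 2530146; 4210536; 2546013;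
  3610425; 5206134; 5203164; 2560143; 3410265; 0341562; 0145623; 0123564;
  0356124; 0213465; 0346215; 0645312; 0346512; 3025614; 0246531; 3502146;
  3460152; 0546321; 0123564; 1046532; 0324651; 1234650; 1642035; 1546203;
  0156432; 3014625; 3401256; 3560241; 0456312; 0315642; 1204563; 0213465;
  2056431; 1546023; 2456103; 0612453; 2401653; 0621543; 1502643; 0612453;
  1502643; 3410265; 0123645; 4150632; 0352614; 1046532; 0341625; 2056431;
  4106532; 1345602; 2356104; 3601245; 2136504; 2450136; 2356104; 4025613;
  0643215; 1365204; 3145602; 0346215; 4025316; 3621054; 0346215; 0346215;
  4630125; 3601245; 2356104; 0135624; 2541036; 2653104; 2356104; 4520163;
  4165032; 3214650; 3261504; 0346215; 3214605; 4250316; 4135062; 0346215;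
  6231504; 3601245; 3601542; 2501643; 4250136; 3601245; 2501346; 2501346;
  2153604; 3162504; 4250136; 4360125; 4250136; 4250136; 2450163; 2356014;
  0346521; 0453126; 2435106; 3265014; 0462135; 0245631; 3426105; 0436215;
  0425316; 2451063; 2054316; 1643502; 1542603; 2451063; 2530146; 2356014;
  2513064; 2345601; 5462013; 3265014; 3246501; 3612054; 6453012; 4062135;
  4053126; 4215036; 4021356; 2056431; 3065421; 2501346; 2356014; 2530164;
  3610542; 0346215; 2560134; 3610542; 2356014; 5012643; 2053614; 0346215;
  3106542; 3601245; 2345016; 2345016; 1026453; 1452036; 0365124; 0364125;
  1023456; 3601452; 1026453; 1026543; 3604521; 3602451; 0362451; 1023456;
  1452036; 1023546; 1542036; 6302451; 1452036; 1230456; 1230546; 3604512;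
  3601452; 0361452; 1260453; 2451036; 1260543; 2541036; 6301452; 2451036;
  1230456; 3601254; 3605124; 3601245; 3604125; 3601245; 3601245; 1260453;
  3604125; 6305124; 3605124; 6304125; 3604125; 6301245; 3601245; 1365204;
  3014562; 2450136; 1635204; 3610452; 0265413; 0546213; 0235416; 0265413;
  2405361; 0235416; 3610245; 0543216; 3460125; 0235416; 1356042; 2450136;
  3601245; 2450136; 2450163; 3610452; 6105324; 2035461; 3641205; 3160542;
  1340562; 3105624; 3610245; 2065431; 3610524; 4205136; 1356042; 2013456;
  0365214; 0364215; 0126453; 1456023; 2130456; 2130546; 0245631; 3610245;
  1640532; 2045316; 2043561; 2054316; 2053461; 0453126; 2451063; 2450163;
  2451036; 2541036; 0213456; 2451063; 6213045; 6213054; 0453126; 6453012;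
  1640532; 4053126; 4215036; 5043126; 5214036; 0453126; 2451063; 3601452;
  0456123; 2043561; 2053461; 0453126; 3621045; 3601452; 0456123; 1356402;
  1346502; 0453126; 3601245; 1245630; 1235406; 1234506; 1245360; 3601452;
  2453016; 3640125; 3650124; 2456013; 1452036; 1453026; 3640215; 3650214;
  1456023; 2451036; 3605124; 3604125; 3601245; 3601245; 3405612; 3045612;
  3605124; 3054612; 3604125; 6301245; 3601245; 2143560; 3641025; 3601245;
  3460125; 3102645; 3561024; 0356412; 4205136; 3601245; 4023615; 4205136;
  2014356; 1456023; 3601245; 3640125; 3650124; 3601245; 3601452; 1456023;
  3601245; 4215036; 5214036; 3601245; 3601245; 3601245; 2345016; 0452136;
  0641532; 2451036; 2541036; 0341562; 3465102; 0456213; 0546213; 1435602;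
  1465302; 3016425; 0453216; 3160254; 0543216; 3160245; 1435602; 3160245;
  1630245; 1630254; 0143562; 1465302; 0136245; 1360245; 0143562; 1360254;
  0153462; 1360452; 1360452; 1036425; 0451236; 1360254; 0541236; 1360245;
  3415602; 1360245; 1063425; 1036425; 1630254; 1360524; 1630245; 1360425;
  1360245; 1360245; 0641532; 2415360; 2514360; 0341562; 2143560; 0261435;
  3640125; 3641025; 0231465; 3601452; 0641532; 0341562; 0351462; 0341562;
  0346512; 4250163; 4615032; 3415602; 6345102; 3061425; 3514602; 4201536;
  3415602; 5201436; 3415602; 3645102; 1326405; 1236405; 2310654; 2310645;
  1263405; 1236405; 2136405; 1320654; 1320645; 2163405; 2136405; 1230654;
  1230645; 3162405; 3126405; 0123645; 1260354; 1230654; 1260345; 1230645;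
  6123405; 4501236; 1243560; 1246530; 4023561; 4023615; 1243560; 1243560;
  1346520; 1246530; 2360154; 4023615; 1243560; 1243560; 0346521; 0246531;
  0243561; 0253461; 0243561; 0243561; 3465201; 0126435; 0346521; 0356421;
  0123465; 0123465; 0243561; 0243561; 5201643; 0165432; 1243560; 3106542;
  1243560; 5042163; 3146502; 1345602; 1356042; 2046531; 0123456; 4360125;
  2605341; 1532046; 1645320; 1243560; 0216453; 1305642; 2345610; 2345610;
  1043562; 3041652; 4510236; 4015326; 1635024; 2653041; 1635024; 0321465;
  1045326; 4150326; 1503246; 3546120; 1253064; 2156034; 0532416; 4130562;
  4250613; 1206354; 5641230; 3261054; 1253064; 1235046; 2013546; 2653410;
  0213456; 0564312; 1456023; 1365024; 2103456; 1645302; 0245631; 3610245;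
  1653402; 1345602; 4203561; 0123456; 3064215; 1345602; 2450163; 2453016;
  3604125; 0231456; 4501263; 0631245; 0645312; 2453106; 2065413; 2541063;
  1206453; 1365024; 1650324; 3105624; 3265401; 2450631; 2450631; 2106453;
  3615024; 1260543; 4250631; 1345602; 4251063; 1420653; 1420653; 1345602;
  1360254; 1023456; 1653420; 0643215; 2345601; 5102346; 0425613; 3061245;
  0245613; 1453026; 0463215; 1235460; 1435602; 1065423; 1435062; 2345610;
  2106543; 1203456; 4105632; 2561043; 2653014; 2345610; 2405613; 2054613;
  3160542; 3164502; 6403215; 2345601; 2301564; 1605432; 5124306; 2345601;
  2016534; 3160245; 1643205; 3456102; 4126053; 5326041; 1245603; 3260154;
  3461052; 4316052; 5216043; 2154603; 3160245; 3560214; 3460125; 3612045;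
  3461052; 4310625; 4351602; 4316052; 5342601; 5326041; 4210653; 3160245;
  2031456; 0651324; 0654312; 2145603; 2134560; 3601254; 3641025; 3561024;
  3062541; 3561024; 6203145; 6015324; 2134560; 3206541; 2134560; 4230156;
  3601245; 3615024; 3601254; 4251063; 3601245; 3601524; 4205136; 5214063;
  3062541; 1420653; 4053621; 0425361; 3462105; 3621054; 4053621; 6432105;
  4053621; 3564210; 0214536; 4203615; 4051362; 2536104; 4263015; 4306152;
  3641205; 3126504; 0321654; 4236015; 3621054; 4603152; 4503162; 4560321;
  2536104; 0653421; 3601245; 1652304; 1356042; 0123456; 0123456; 0123456;
  1243560; 0123456; 0123456; 4230561; 0135624; 2561043; 4015632; 6543210;
  4205613; 4306152; 3642105; 4210635; 0632154; 0653421; 4206513; 1243560;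
  1243560; 0653421; 1243560; 2135604; 4025613; 3201465; 4062135; 4601253;
  4250163; 2651304; 3162504; 4360125; 5126304; 6231504; 3561204; 0123456;
  0123456; 0132456; 0132456; 0645321; 4165023; 0324651; 0564321; 1065432;
  2065431; 3620145; 4231560; 3064125; 0213456; 0213456; 3560142; 3460152;
  3612054; 1254603; 4150632; 0645321; 3560142; 0654312; 0564321; 5012346;
  1254603; 3046512; 3456012; 4125603; 0654321; 1245603; 1234560; 3160245;
  3562014; 3062514; 0654321; 1245603; 1234560; 2356014; 3146502; 2035614;
  0643215; 0123456; 0123456; 2356014; 3061245; 2650314; 0643215; 2345601;
  3106542; 3546012; 3016542; 2365014; 0246531; 0235614; 4103562; 0243561;
  3546201; 5360124; 2645301; 1356402; 2436501; 2345601; 3245601; 0356412;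
  0356421; 0356412; 1362504; 3601254; 5123604; 1632504; 0356412; 4013562;
  1536420; 2436510; 4021536; 5023614; 4013625; 4021563; 1536420; 0243561;
  0124356; 0123456; 4123560; 5123460; 0216453; 3452016; 1453026; 1453206;
  1543206; 2106453; 1453206; 1203456; 2456103; 2546103; 2456013; 1203456;
  0456123; 0546123; 3612045; 3612045; 1340562; 0453216; 5302164; 0543216;
  4302165; 6321045; 3021645; 2456013; 0456123; 2046531; 2056431; 3210645;
  2456103; 0164532; 0456123; 1046532; 1056432; 3106452; 1064532; 1456023;
  2456013; 1456023; 3601245; 3560124; 3460125; 3601245; 1206453; 1246530;
  0246531; 2645310; 3562014; 0362514; 4016325; 3120654; 0246531; 3201645;
  4532061; 3016452; 3610245; 3201654; 3201645; 6320145; 1023465; 2456013;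
  0123465; 3456012; 3456021; 3456012; 0456123; 1043562; 1053462; 0453126;
  3456120; 0123456; 4053612; 0124653; 0235614; 5123604; 0124356; 0124356;
  0214653; 0135624; 5213604; 0214356; 0214356; 3012465; 0312465; 3612045;
  4530126; 4103562; 4501236; 3612054; 0612435; 5123604; 4560123; 3601245;
  0156432; 0156423; 0123456; 0123465; 0123456; 0123456; 1564320; 1564230;
  4205613; 1234650; 1234560; 2561304; 0453126; 1023456; 3610245; 3065214;
  3064215; 0123456; 0123456; 3620145; 3065124; 3064125; 0213456; 0213456;
  3456120; 3460152; 3612045; 3612045; 0465312; 0645312; 1046532; 0654312;
  1056432; 6123450; 3120645; 0123456; 4210563; 0564321; 0123465; 0123456;
  0123456; 2563014; 4210536; 0564321; 0564321; 0654321; 0564321; 0234561;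
  0234561; 0125643; 0132456; 1256403; 2065431; 2056431; 2056431; 0156432;
  2156403; 1065432; 1056432; 1056432; 1230456; 4012563; 4012563; 4012563;
  0546312; 0512346; 1234056; 0561234; 1065432; 1056432; 1056432; 0215643;
  0245613; 1345602; 0123456; 0123465; 0123456; 0213456; 0456123; 2045631;
  0564321; 0654321; 1056432; 0125643; 0564231; 0564132; 4012563; 3560124;
  0564312; 0654312; 0564132; 2456013; 0123456; 0345612; 1563204; 2056413;
  3561024; 0513624; 0231456; 0231465; 0231456; 0156423; 0256413; 0356412;
  4015623; 4012365; 4012356; 0561423; 0156423; 0245631; 0346512; 4201563;
  0165432; 0215643; 1230456; 2051643; 5034216; 0165432; 0156423; 0156432;
  0156423; 4102365; 0156423; 4510236; 0156423; 4103265; 4125036; 5134026;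
  4521036; 5431026; 6432015; 4102356; 0125643; 0125643; 0123456; 0123456;
  0132456; 2135640; 2134650; 2134560; 2310456; 0231456; 1235640; 1234650;
  1234560; 1320456; 1325640; 1324650; 1324560; 1230456; 0456123; 0465123;
  1235640; 0564123; 1234650; 1234560; 1230456; 0245613; 0123456; 4501236;
  0321456; 1230456; 1230546; 1230645; 0456123; 0123456; 0134562; 0456123;
  0531624; 1056432; 1065432; 1034562; 0456231; 0456231; 0145623; 0245613;
  0136524; 0243615; 0134526; 3150462; 0425613; 0246135; 0625413; 2460135;
  0423615; 0132546; 2460351; 0623415; 2460153; 2410635; 2460351; 0316524;
  0241635; 0314526; 1350462; 0516324; 0135246; 1350246; 0514326; 1320546;
  1350264; 1350462; 0421635; 0312546; 1350264; 0621435; 2460351; 1350246;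
  1350246; 0512346; 1340526; 1350462; 1350264; 1360524; 1530246; 1350246;
  1350246; 1246350; 5012346; 1426350; 3012546; 1624350; 1246035; 5021346;
  2416350; 3021546; 2614350; 2146035; 5041326; 3501246; 5061324; 3501246;
  3041526; 4612350; 3501264; 3061524; 3012546; 3501246; 3501246; 0134562;
  6410235; 0625413; 3156024; 0132564; 6210435; 0623415; 5136024; 1036524;
  2460135; 2460135; 3501246; 2460135; 2460135; 2460135; 2630415; 2406351;
  1560324; 2460513; 2650413; 4260135; 3510246; 1360524; 2460315; 3510624;
  1350264; 3501462; 5012346; 3501264; 3102546; 3501246; 5012346; 2416035;
  3501246; 3501246; 3501246; 3501246; 2416035; 3520146; 3510462; 2160435;
  3104562; 2140635; 2460135; 3501426; 2406135; 3501264; 2406153; 3501246;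
  2460135; 2460135; 2346015; 1206543; 1450236; 1346502; 1306452; 0354612;
  1256403; 1540326; 1206543; 0245613; 1452306; 1540326; 1256403; 1450236;
  1346502; 2460135; 4601325; 2165403; 2105643; 2640315; 0146523; 2640315;
  2461305; 2165403; 1450236; 1450236; 1306452; 4502316; 2640315; 1540326;
  1540326; 3561204; 2105643; 1206543; 5403216; 4503216; 0621345; 0512346;
  1304652; 0413256; 1205643; 2106543; 1426350; 2460135; 0364521; 3560124;
  0265431; 4125603; 3056214; 5134602; 2046315; 2460135; 4601325; 0146523;
  3104652; 3120546; 2643105; 4652013; 2130456; 2105643; 3652104; 5643012;
  0621345; 0512346; 1304652; 0413256; 1205643; 2106543; 1245603; 1023456;
  2065431; 3024651; 0234651; 1056423; 6054321; 0234651; 4103652; 2560314;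
  2563041; 5024316; 2563041; 1564032; 2054613; 4201563; 2653014; 5230614;
  1234065; 2063514; 4106325; 2346501; 5326014; 2653014; 3501462; 5012346;
  0132546; 2160453; 3054621; 2140653; 3054621; 2460153; 2461035; 3501426;
  2641035; 2461053; 2601453; 5120346; 2401653; 3501462; 2165043; 0521346;
  3540621; 2145063; 3054621; 3560421; 2461053; 2461035; 2461035; 0256431;
  1654302; 0254613; 0254613; 5306124; 1543206; 4015236; 5321064; 2643015;
  2165403; 4125036; 2345601; 2461035; 6035214; 3561204; 4015236; 5123046;
  2560431; 4210653; 4125306; 2540613; 4603125; 4015236; 5103246; 4601235;
  0256431; 0134652; 1346502; 2460135; 2460135; 4021356; 0465123; 0653214;
  1346502; 1345602; 4021356; 3610245; 1536420; 5023614; 4103625; 1563420;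
  5236014; 2436510; 5203614; 4013625; 2463510; 4136025; 4160235; 5260134;
  3461205; 3461205; 4103625; 4130265; 4130265; 5230164; 4103625; 6431205;
  3410265; 4013562; 2365104; 3265014; 1653402; 4106532; 1456023; 4102635;
  3245601; 1204653; 2436501; 2345601; 2645310; 4105623; 1035462; 3642105;
  3265014; 2046531; 3256014; 0362514; 4150623; 2436501; 3120654; 2653041;
  1034652; 0256413; 2301465; 0231456; 4052316; 3651024; 1653204; 0256413;
  4201365; 2056413; 4025316; 1530264; 2461035; 2546103; 4152306; 4261035;
  6432015; 4201653; 0345612; 0254613; 4125306; 5134206; 6432015; 2016543;
  4201356; 2016543; 1356024; 1345602; 1350624; 1436502; 1435602; 1356024;
  2056413; 2560413; 2056413; 2065413; 2564130; 1564032; 2056413; 2065413;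
  1345602; 1305624; 1306524; 1356024; 1560234; 1436502; 1435602; 1345602;
  5320146; 1560324; 3450126; 0432651; 1056324; 3450126; 4360215; 2650413;
  2065413; 0341562; 4360215; 1562340; 3512064; 1560324; 3156024; 2650413;
  4621053; 4265013; 1360542; 2450631; 1360542; 1563042; 2465013; 0245613;
  3251046; 3104562; 3251064; 2465103; 4360215; 4621053; 3501264; 4601235;
  3501246; 2456031; 1245603; 4610253; 4620153; 3501246; 3501264; 1246503;
  3501246; 3501246; 3014562; 3014562; 4602153; 0246513; 4632051; 0146325;
  6432051; 3014562; 3250146; 3450126; 3510264; 3510264; 3501264; 4632150;
  3541260; 1350624; 2465013; 3014562; 3501246; 3501246; 3502146; 0465123;
  0356124; 0463125; 0354126; 3051246; 3051246; 0234561; 0134562; 0124563;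
  0123564; 5012346; 0123546; 0123546; 0123546; 2340165; 0123546; 3201546;
  0246513; 1263405; 3105462; 1243605; 3201546; 5120346; 2165403; 0146325;
  2145603; 4610235; 0465123; 3210546; 0645123; 2046513; 0463215; 3201546;
  3201564; 0643215; 1046325; 3201546; 3201546; 0364512; 0246513; 1345602;
  1205643; 0654321; 1345602; 0165432; 2156403; 2346501; 4302156; 1203465;
  1230465; 1205643; 0645123; 1564302; 4210563; 1340652; 2156403; 3150642;
  1205643; 4302156; 4302156; 4620135; 2605431; 0132654; 0162345; 2304561;
  2304561; 3061542; 4032165; 0563214; 0436215; 3126054; 2304561; 2354016;
  2014356; 0123546; 0213546; 5012436; 0465312; 3046125; 0645312; 1324560;
  0123546; 2346015; 0124563; 0123564; 1034562; 0123546; 0123546; 0234561;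
  0123456; 1543206; 0254613; 2304561; 0632451; 1345602; 1345602; 1203456;
  0361542; 1346520; 0143562; 2456103; 1540326; 0412653; 1203456; 1203456;
  1340562; 0521346; 1340562; 1234560; 1605432; 2106543; 1203456; 0236514;
  0146523; 0214653; 0123654; 1230564; 3412056; 0146523; 0234561; 0143562;
  1203546; 0465321; 0436215; 0645321; 1054632; 0234561; 1345602; 2456013;
  1203456; 1340562; 1340562; 2065431; 1203456; 0234561; 0234561; 0123456;
  0124356; 0123465; 0143562; 0245613; 0456132; 0416235; 0512346; 1054632;
  0234561; 0134562; 1034562; 1043562; 1203546; 1063542; 1034562; 0234561;
  0134562; 0465123; 0312654; 0461325; 0534126; 1034562; 0234561; 0123456;
  0234561; 0134562; 0412563; 0312564; 0612345; 0512346; 1034562; 0123456;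
  0123456; 0123456]%dec_uint.

(** * The check that all graphs on seven vertices are realized *)

Definition representatives7 : seq bmatrix :=
  next relabellings7 (representatives relabellings).

Lemma covers_representatives7 : covers 7 representatives7.
Proof.
exact: (covers_next relabellings7 (@covers_representatives relabellings)).
Qed.

(** The matrices are flattened to serve as keys of the prefix tree. *)
Lemma representatives7_realized :
  {subset map flatten representatives7 <=
     map flatten (wheel :: caterpillar_graphs)}.
Proof. by apply: trie_subset; vm_compute. Qed.

Lemma seven_vertices (T : eqType) (E : rel T) (s : seq T) :
  symmetric E -> irreflexive E -> size s = 7 ->
  exists2 s', perm_eq s s' & adjacency E s' \in wheel :: caterpillar_graphs.
Proof.
move=> symE irrE size_s.
have [s' perm_s' adj_s'] := covers_representatives7 symE irrE size_s.
exists s'; first exact: perm_s'.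
move: adj_s' => /(map_f flatten)/representatives7_realized/mapP[M M_in flat_eq].
suff -> : adjacency E s' = M by exact: M_in.
(* Flattening forgets only the shape, and both matrices are 7 by 7. *)
apply: eq_from_flatten_shape; first exact: flat_eq.
have -> : shape (adjacency E s') = nseq 7 7.
  have size_s' : size s' = 7 by rewrite -(perm_size perm_s').
  have /all_pred1P -> : all (pred1 7) (shape (adjacency E s')).
    by rewrite /shape !all_map; apply/allP=> x _ /=; rewrite size_map size_s'.
  by rewrite !size_map size_s'.
by move: M_in; rewrite inE => /orP[/eqP -> //|/flatten_mapP[t _ /mapP[v _ ->]]].
Qed.

Theorem theorem2 (R : realType) (V : finType) (E : rel V) :
  simple_graph E -> (#|V| <= 7)%N -> is_PCG R E.
Proof.
case=> symE irrE V7; have [V1|V2] := leqP #|V| 1; first exact: small_PCG.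
have /card_gt0P[x0 _] : 0 < #|V| by exact: ltnW.
pose vert i := nth x0 (enum V) i; pose rk v := index v (enum V).
have rkK v : vert (rk v) = v by rewrite /vert nth_index ?mem_enum.
have rk_lt v : rk v < #|V| by rewrite cardE index_mem mem_enum.
(* Vertices are numbered from 0, and the numbers from #|V| to 6 serve as the added isolated
   vertices. *)
pose E' : rel nat := fun i j => [&& i < #|V|, j < #|V| & E (vert i) (vert j)].
have symE' : symmetric E' by move=> i j; rewrite /E' symE andbCA.
have irrE' : irreflexive E' by move=> i; rewrite /E' irrE !andbF.
have [s perm_s adj_s] := seven_vertices symE' irrE' (size_iota 0 7).
have size_s : size s = 7 by rewrite -(perm_size perm_s).
have s_uniq : uniq s by rewrite -(perm_uniq perm_s) iota_uniq.
have s_mem i : (i \in s) = (i < 7) by rewrite -(perm_mem perm_s) mem_iota.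
have rk_s v : rk v \in s by rewrite s_mem (leq_trans (rk_lt v)).
(* The row of [v] in the realized matrix, which lists the numbers in the order of [s]. *)
pose q v := index (rk v) s.
have q_lt v : q v < 7 by rewrite -size_s index_mem.
have q_inj : injective q.
  move=> u v /(congr1 (nth 0 s)); rewrite !nth_index // => eq_rk.
  by rewrite -(rkK u) eq_rk rkK.
have nth_adj i j : i < 7 -> j < 7 ->
    nth false (nth [::] (adjacency E' s) i) j = E' (nth 0 s i) (nth 0 s j).
  by move=> i7 j7; rewrite !(nth_map 0) ?size_s.
have EE u v : E u v = nth false (nth [::] (adjacency E' s) (q u)) (q v).
  by rewrite nth_adj // !nth_index // /E' !rk_lt !rkK.
move: adj_s; rewrite inE => /orP[/eqP adj_wheel|M_cat]; last first.
  by apply: caterpillar_graph_PCG V2 q_inj q_lt M_cat _ => u v _; exact: EE.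
have V_eq7 : #|V| = 7.
  apply/eqP; rewrite eqn_leq V7 leqNgt; apply/negP=> V_lt7.
  (* Then 6 is isolated for E', but the wheel has no isolated vertex. *)
  have k_lt : index 6 s < 7 by rewrite -size_s index_mem s_mem.
  have : has id (nth [::] wheel (index 6 s)).
    by move: (index 6 s) k_lt; do 7?[case=> //].
  rewrite -adj_wheel (nth_map 0) ?size_s // nth_index ?s_mem //.
  by rewrite has_map => /hasP[j _] /=; rewrite /E' ltnNge -ltnS V_lt7.
apply: (@wheel_PCG R V E q q_inj q_lt) => [k k7|u v _]; last first.
  by rewrite -adj_wheel EE.
(* With exactly seven vertices every row of the wheel belongs to a vertex, which gives the
   surjectivity that [wheel_PCG] asks for. *)
have k_s : nth 0 s k < #|V| by rewrite V_eq7 -s_mem mem_nth ?size_s.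
exists (vert (nth 0 s k)).
by rewrite /q /rk /vert !index_uniq ?enum_uniq ?size_s -?cardE.
Qed.
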